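(* For any constant $c>0$ and $\ell(y,y')=|y-y'|$, there exist a distribution $\mathcal{D}_I$, a hypothesis class $\mathcal{F}$ and a target function $f^*\in\mathcal{F}$ such that for $$f_1=\arg\min_{f\in\mathcal{F}}\max_{f'\in\widetilde{\mathcal{F}}_0}\mathbb{E}[\ell(f(X),f'(X))]\quad\text{and}\quad f_2=\arg\min_{f\in\mathcal{F}}\mathbb{E}[\rho_\ell(f(X),L,U)],$$ one has $\operatorname{err}(f_1)=0$ while $\operatorname{err}(f_2)>c$.
   Context: $\mathcal{X}$ is a feature space, $\mathcal{Y}=\mathbb{R}$ is the label space, hypotheses are functions $\mathcal{X}\to\mathcal{Y}$, and labels are deterministic, $y=f^*(x)$. $\mathcal{D}_I$ is a distribution of triples $(X,L,U)$ of a feature together with lower and upper bounds, always satisfying $f^*(X)\in[L,U]$. $\operatorname{err}(f)=\mathbb{E}[\ell(f(X),f^*(X))]$. The projection loss is $\pi_\ell(f(x),l,u)=\min_{\tilde y\in[l,u]}\ell(f(x),\tilde y)$, and $\widetilde{\mathcal{F}}_0=\{f\in\mathcal{F}:\mathbb{E}[\pi_\ell(f(X),L,U)]\le 0\}$, i.e. the hypotheses with expected projection loss zero. The worst-case loss is $\rho_\ell(f(x),l,u)=\max_{\tilde y\in[l,u]}\ell(f(x),\tilde y)$. *)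

(* Defs.v *)
From HB Require Import structures.
From mathcomp Require Import all_boot all_order all_algebra.
From mathcomp Require Import all_classical all_reals all_analysis.
Set Implicit Arguments.
Unset Strict Implicit.
Unset Printing Implicit Defensive.
Import Order.TTheory GRing.Theory Num.Theory.
Import numFieldNormedType.Exports.
Local Open Scope classical_set_scope.
Local Open Scope ring_scope.

(* A triple (x, l, u) is encoded as z = (x, (l, u)), so that x = z.1, l = z.2.1
   and u = z.2.2. R carries its Borel sigma-algebra. *)

Definition abs_loss (R : realType) (y y' : R) : R := `|y - y'|.

(* The minimum and maximum over [l, u] are taken as an infimum and a supremum
   in \bar R: for l <= u and a continuous loss they are attained. *)
Definition proj_loss (R : realType) (ell : R -> R -> R) (y l u : R) : \bar R :=
  ereal_inf [set (ell y yt)%:E | yt in `[l, u]].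

Definition worst_loss (R : realType) (ell : R -> R -> R) (y l u : R) : \bar R :=
  ereal_sup [set (ell y yt)%:E | yt in `[l, u]].

Definition bounds_valid (R : realType) (d : measure_display)
    (X : measurableType d) (D : probability (X * (R * R))%type R)
    (fstar : X -> R) : Prop :=
  {ae D, forall z, z.2.1 <= fstar z.1 <= z.2.2}.

Definition disagreement (R : realType) (d : measure_display)
    (X : measurableType d) (D : probability (X * (R * R))%type R)
    (ell : R -> R -> R) (f f' : X -> R) : \bar R :=
  (\int[D]_z (ell (f z.1) (f' z.1))%:E)%E.

Definition err (R : realType) (d : measure_display)
    (X : measurableType d) (D : probability (X * (R * R))%type R)
    (ell : R -> R -> R) (fstar f : X -> R) : \bar R :=
  disagreement D ell f fstar.

Definition exp_proj_loss (R : realType) (d : measure_display)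
    (X : measurableType d) (D : probability (X * (R * R))%type R)
    (ell : R -> R -> R) (f : X -> R) : \bar R :=
  (\int[D]_z proj_loss ell (f z.1) z.2.1 z.2.2)%E.

Definition exp_worst_loss (R : realType) (d : measure_display)
    (X : measurableType d) (D : probability (X * (R * R))%type R)
    (ell : R -> R -> R) (f : X -> R) : \bar R :=
  (\int[D]_z worst_loss ell (f z.1) z.2.1 z.2.2)%E.

Definition Ftilde0 (R : realType) (d : measure_display)
    (X : measurableType d) (D : probability (X * (R * R))%type R)
    (ell : R -> R -> R) (F : set (X -> R)) : set (X -> R) :=
  [set f | F f /\ (exp_proj_loss D ell f <= 0)%E].

Definition max_disagreement (R : realType) (d : measure_display)
    (X : measurableType d) (D : probability (X * (R * R))%type R)
    (ell : R -> R -> R) (F : set (X -> R)) (f : X -> R) : \bar R :=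
  ereal_sup [set disagreement D ell f f' | f' in Ftilde0 D ell F].

Definition argmin (R : realType) (T : Type) (A : set T) (J : T -> \bar R) :
    set T :=
  [set f | A f /\ forall g, A g -> (J f <= J g)%E].

(* Main.v *)
(* Let the feature be constant, the interval be [0, 4 c] with probability 3/4
   and [0, 0] with probability 1/4, and F consist of the constants 0 (the
   target) and 2 c. Both intervals contain 0 but [0, 0] excludes 2 c, so 0 is
   the only hypothesis with zero projection loss and f_1 = 0. The expected
   worst-case loss is 3 c at 0 but only 2 c at the midpoint 2 c of the likely
   interval, so f_2 = 2 c. *)
Require Import Defs.
From HB Require Import structures.
From mathcomp Require Import all_boot all_order all_algebra.
From mathcomp Require Import all_classical all_reals all_analysis.
From mathcomp Require Import measurable_realfun lra.
Import Order.TTheory GRing.Theory Num.Theory.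
Import numFieldNormedType.Exports.
Local Open Scope classical_set_scope.
Local Open Scope ring_scope.

(** The infimum is the distance from [y] to the interval. When [u < l] it ranges over the empty set,
    hence [+oo]. This closed form makes measurability in [(l, u)] visible. *)
Lemma proj_loss_absE (R : realType) (y l u : R) :
  proj_loss (@abs_loss R) y l u
    = if l <= u then (Num.max 0 (Num.max (l - y) (y - u)))%:E else +oo%E.
Proof.
rewrite /proj_loss /abs_loss; case: ifPn => [lu|]; last first.
  by rewrite -ltNge => ul; rewrite set_itv_ge ?bnd_simp -?ltNge// image_set0
    ereal_inf0.
apply/le_anti/andP; split.
(* The witness is [y] clamped to [[l, u]], its nearest point there. *)
- apply: ereal_inf_lbound; exists (Num.max l (Num.min y u)).
    by rewrite /= in_itv/=; apply/andP; split; rewrite maxEle minEle;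
      repeat case: ifPn; rewrite -?ltNge; lra.
  congr EFin; rewrite !maxEle minEle.
  repeat case: ifPn; rewrite -?ltNge => *;
    solve [lra | rewrite ger0_norm; lra | rewrite ler0_norm; lra].
- apply: le_ereal_inf_tmp => _ [t /= + <-]; rewrite in_itv/= => /andP[lt tu].
  rewrite lee_fin !ge_max normr_ge0/=.
  have := ler_norm (y - t); have := ler_norm (- (y - t)); rewrite normrN.
  by move=> ? ?; apply/andP; split; lra.
Qed.

(** The map [t |-> |y - t|] is convex, so its supremum over an interval is reached at an endpoint;
    the supremum of the empty set is [-oo]. *)
Lemma worst_loss_absE (R : realType) (y l u : R) :
  worst_loss (@abs_loss R) y l u
    = if l <= u then (Num.max `|y - l| `|y - u|)%:E else -oo%E.
Proof.
rewrite /worst_loss /abs_loss; case: ifPn => [lu|]; last first.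
  by rewrite -ltNge => ul; rewrite set_itv_ge ?bnd_simp -?ltNge// image_set0
    ereal_sup0.
apply/le_anti/andP; split.
- apply: ge_ereal_sup => _ [t /= + <-]; rewrite in_itv/= => /andP[lt tu].
  rewrite lee_fin le_max.
  have := ler_norm (y - l); have := ler_norm (- (y - u)); rewrite normrN.
  (* A point [t] left of [y] is dominated by [l], one right of [y] by [u]. *)
  move=> ? ?; have [yt|yt] := leP 0 (y - t).
    by rewrite ger0_norm//; apply/orP; left; lra.
  by rewrite ltr0_norm//; apply/orP; right; lra.
- rewrite EFin_max ge_max; apply/andP; split; apply: ereal_sup_ubound.
    by exists l => //=; rewrite in_itv/= lexx lu.
  by exists u => //=; rewrite in_itv/= lexx lu.
Qed.

Section interval_data.
Context (R : realType) (d : measure_display) (X : measurableType d).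
Implicit Types (a b y : R) (z : X * (R * R)).

Lemma measurable_lower :
  measurable_fun [set: X * (R * R)] (fun z => z.2.1).
Proof. exact: (measurableT_comp measurable_fst measurable_snd). Qed.

Lemma measurable_upper :
  measurable_fun [set: X * (R * R)] (fun z => z.2.2).
Proof. exact: (measurableT_comp measurable_snd measurable_snd). Qed.

Lemma measurable_proj_loss_abs y :
  measurable_fun [set: X * (R * R)]
    (fun z => proj_loss (@abs_loss R) y z.2.1 z.2.2).
Proof.
have [ml mu] := (measurable_lower, measurable_upper).
under eq_fun do rewrite proj_loss_absE.
apply: measurable_fun_ifT => //; first exact: measurable_fun_ler.
apply: measurableT_comp => //; apply: measurable_maxr => //.
by apply: measurable_maxr; exact: measurable_funB.
Qed.

Lemma measurable_worst_loss_abs y :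
  measurable_fun [set: X * (R * R)]
    (fun z => worst_loss (@abs_loss R) y z.2.1 z.2.2).
Proof.
have [ml mu] := (measurable_lower, measurable_upper).
under eq_fun do rewrite worst_loss_absE.
apply: measurable_fun_ifT => //; first exact: measurable_fun_ler.
apply: measurableT_comp => //; apply: measurable_maxr;
  by apply: measurableT_comp => //; exact: measurable_funB.
Qed.

Lemma disagreement_cst (D : probability (X * (R * R))%type R)
    (ell : R -> R -> R) a b :
  disagreement D ell (cst a) (cst b) = (ell a b)%:E.
Proof.
rewrite /disagreement/= integral_cst//.
by rewrite [X in (_ * X)%E]probability_setT mule1.
Qed.

End interval_data.

(** The law is the image of a Bernoulli law under a map from [bool]. Sign and finiteness of [g] are
    asked only at the two atoms, because the worst-case loss is [-oo] on triples with [l > u]. *)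
Lemma two_point_probability (R : realType) (d : measure_display)
    (T : measurableType d) (p : R) (s t : T) : 0 <= p <= 1 ->
  exists P : probability T R,
    (forall B, measurable B -> ~ B s -> ~ B t -> P B = 0%E) /\
    (forall g : T -> \bar R, measurable_fun [set: T] g ->
       (0 <= g s < +oo)%E -> (0 <= g t < +oo)%E ->
       (\int[P]_z g z = p%:E * g s + (1 - p)%:E * g t)%E).
Proof.
move=> p01; pose phi (b : bool) := if b then s else t.
have mphi : measurable_fun [set: bool] phi by [].
pose Phi : {mfun bool >-> T} := mfun_Sub (mem_set mphi).
exists (distribution (bernoulli_prob p) Phi); split=> [B mB nBs nBt|g mg].
  rewrite /distribution/= /pushforward (_ : _ @^-1` _ = set0) ?measure0//.
  by apply/seteqP; split=> // -[].
move=> /andP[gs0 gsoo] /andP[gt0 gtoo].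
have gphi0 b : (0 <= (g \o phi) b)%E by case: b.
(* As [g] may be negative elsewhere, the change of variables goes through integrability, checked on
   [bool], where [g \o phi] is nonnegative and finite. *)
have int_gphi : (bernoulli_prob p).-integrable [set: bool] (g \o phi).
  apply/integrableP; split => //.
  under eq_integral do rewrite gee0_abs//.
  rewrite (integral_bernoulli_prob p01)//=.
  by rewrite lte_add_pinfty// lte_mul_pinfty// lee_fin;
    case/andP: p01 => *; rewrite ?subr_ge0.
rewrite /distribution (integral_pushforward mphi)//=.
exact: integral_bernoulli_prob.
Qed.

Theorem proposition5p4 (R : realType) (d : measure_display)
    (X : measurableType d) (c : R) (hc : 0 < c) :
  exists (D : probability (X * (R * R))%type R) (F : set (X -> R))
         (fstar : X -> R),
    [/\ (forall f, F f -> measurable_fun [set: X] f),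
        F fstar,
        bounds_valid D fstar,
        (* the maximum defining the objective of f_1 is attained *)
        (forall f, F f -> exists2 f', Ftilde0 D (@abs_loss R) F f' &
           disagreement D (@abs_loss R) f f'
             = max_disagreement D (@abs_loss R) F f) &
        [/\ argmin F (max_disagreement D (@abs_loss R) F) !=set0,
            argmin F (exp_worst_loss D (@abs_loss R)) !=set0 &
            forall f1 f2 : X -> R,
              argmin F (max_disagreement D (@abs_loss R) F) f1 ->
              argmin F (exp_worst_loss D (@abs_loss R)) f2 ->
              err D (@abs_loss R) fstar f1 = 0%E /\
              (c%:E < err D (@abs_loss R) fstar f2)%E]].
Proof.
have p01 : 0 <= (3 / 4 : R) <= 1 by lra.
have [D [D0 intD]] := two_point_probability R _ (X * (R * R))%type (3 / 4)
  (point, (0, 4 * c)) (point, (0, 0)) p01.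
have proj_small y : 0 <= y ->
    proj_loss (@abs_loss R) y 0 0 = y%:E.
  by move=> y0; rewrite proj_loss_absE lexx sub0r subr0; congr EFin;
    rewrite !maxEle; repeat case: ifPn; rewrite -?ltNge; lra.
have proj_big y : 0 <= y <= 4 * c ->
    proj_loss (@abs_loss R) y 0 (4 * c) = 0%E.
  move=> /andP[y0 yc]; rewrite proj_loss_absE ifT; last lra.
  by congr EFin; rewrite !maxEle; repeat case: ifPn; rewrite -?ltNge; lra.
have worst_small y : 0 <= y ->
    worst_loss (@abs_loss R) y 0 0 = y%:E.
  by move=> y0; rewrite worst_loss_absE lexx subr0 maxxx ger0_norm.
(* Up to the midpoint [2 * c], the farthest endpoint is [4 * c]. *)
have worst_big y : 0 <= y <= 2 * c ->
    worst_loss (@abs_loss R) y 0 (4 * c) = (4 * c - y)%:E.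
  move=> /andP[y0 yc]; rewrite worst_loss_absE ifT; last lra.
  rewrite subr0 ger0_norm// ler0_norm; last lra.
  by congr EFin; rewrite maxEle; case: ifPn; rewrite -?ltNge; lra.
have projE y : 0 <= y <= 2 * c ->
    exp_proj_loss D (@abs_loss R) (cst y) = (y / 4)%:E.
  move=> /andP[y0 y2]; have y4 : 0 <= y <= 4 * c by lra.
  rewrite /exp_proj_loss intD/=.
  - by rewrite proj_small// proj_big// mule0 add0e -EFinM; congr EFin; lra.
  - exact: measurable_proj_loss_abs.
  - by rewrite proj_big// lexx ltry.
  - by rewrite proj_small// lee_fin y0 ltry.
(* The value is [3/4 * (4 * c - y) + 1/4 * y], which decreases in [y] and so favours [2 * c] over
   [0]. *)
have worstE y : 0 <= y <= 2 * c ->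
    exp_worst_loss D (@abs_loss R) (cst y) = (3 * c - y / 2)%:E.
  move=> y02; have [y0 y2] := andP y02; have y4 : 0 <= 4 * c - y by lra.
  rewrite /exp_worst_loss intD/=.
  - rewrite worst_small// worst_big// -!EFinM -EFinD; congr EFin; lra.
  - exact: measurable_worst_loss_abs.
  - by rewrite worst_big// lee_fin y4 ltry.
  - by rewrite worst_small// lee_fin y0 ltry.
pose F : set (X -> R) := [set cst 0; cst (2 * c)].
have F0 : F (cst 0) by left.
have F2 : F (cst (2 * c)) by right.
have r0 : 0 <= (0 : R) <= 2 * c by lra.
have r2 : 0 <= 2 * c <= 2 * c by lra.
(* The constant [2 * c] has expected projection loss [c / 2 > 0], so it is excluded. *)
have FtE : Ftilde0 D (@abs_loss R) F = [set cst 0].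
  apply/seteqP; split=> f /=.
    by move=> [[->//|->]]; rewrite projE// lee_fin => ?; exfalso; lra.
  by move=> ->; split=> //; rewrite projE// lee_fin; lra.
have maxE f : max_disagreement D (@abs_loss R) F f =
    disagreement D (@abs_loss R) f (cst 0).
  by rewrite /max_disagreement FtE image_set1 ereal_sup1.
have dis0 : disagreement D (@abs_loss R) (cst 0) (cst 0) = 0%E :> \bar R.
  by rewrite disagreement_cst /abs_loss subrr normr0.
have dis2 : disagreement D (@abs_loss R) (cst (2 * c)) (cst 0) = (2 * c)%:E.
  by rewrite disagreement_cst /abs_loss subr0 ger0_norm//; lra.
exists D, F, (cst 0); split => //.
- by move=> f [->|->].
(* The set where the bounds fail is itself measurable, and it is null since it contains neither
   atom. *)
- have mB : measurable [set z : X * (R * R) | ~~ (z.2.1 <= 0 <= z.2.2)].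
    rewrite -[X in measurable X]setTI.
    have : measurable_fun [set: X * (R * R)]
        (fun z => ~~ (z.2.1 <= 0 <= z.2.2)).
      apply: measurable_neg; apply: measurable_and; apply: measurable_fun_ler;
        by [exact: measurable_lower | exact: measurable_upper |].
    by move=> /(_ measurableT [set true]); exact.
  exists [set z | ~~ (z.2.1 <= 0 <= z.2.2)]; split=> //=.
    by apply: D0 => //=; lra.
  by move=> z /= /negP.
- by move=> f Ff; exists (cst 0); [rewrite FtE|rewrite maxE].
- split.
  + exists (cst 0); split=> // g Fg; rewrite !maxE dis0.
    by case: Fg => ->; rewrite ?dis0 ?dis2 lee_fin; lra.
  + exists (cst (2 * c)); split=> // g Fg.
    by case: Fg => ->; rewrite !worstE// lee_fin; lra.
  + move=> f1 f2 [Ff1 min1] [Ff2 min2]; split.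
      (* Were [f1] the constant [2 * c], comparison with [0] would give [2 * c <= 0]. *)
      case: Ff1 min1 => -> // /(_ _ F0).
      by rewrite !maxE dis0 dis2 lee_fin => ?; exfalso; lra.
    (* Were [f2] the constant [0], comparison with [2 * c] would give [3 * c <= 2 * c]. Otherwise
       the error is [2 * c > c]. *)
    case: Ff2 min2 => -> => [/(_ _ F2)|_].
      by rewrite !worstE// lee_fin => ?; exfalso; lra.
    by rewrite /err dis2 lte_fin; lra.
Qed.
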